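(* Let $G$ be a connected edge-transitive graph that is not a star. Then every induced path of length at most $3$ in $G$ closes to an induced cycle. Moreover, for every integer $\ell\geq 4$, there exists a connected edge-transitive graph containing an induced path of length $\ell$ not contained in any induced cycle.
   Context: All graphs are finite, simple and undirected. A star is a complete bipartite graph $K_{1,n}$ for some $n\ge 0$. A graph is edge-transitive if for every two edges $e,f$ there is an automorphism mapping $e$ to $f$. A path of length $\ell$ in $G$ is a sequence $(x_0,\dots,x_\ell)$ of pairwise distinct vertices with $x_i x_{i+1}\in E(G)$ for $0\le i\le \ell-1$ (length $0$ means a single vertex). A cycle is a sequence $(x_0,\dots,x_{\ell-1},x_\ell=x_0)$ with $\ell\ge 3$, $x_0,\dots,x_{\ell-1}$ pairwise distinct and consecutive vertices adjacent. Paths and cycles are identified with the subgraphs formed by their vertices and edges; they are induced if this subgraph is an induced subgraph of $G$. An induced path $P$ closes to an induced cycle if there is an induced cycle $C$ in $G$ such that $P$ is an induced subgraph of $C$. *)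

(* Defs.v *)
From mathcomp Require Import all_boot perm.
Set Implicit Arguments.
Unset Strict Implicit.
Unset Printing Implicit Defensive.

Record sgraph := SGraph {
  vertex :> finType;
  adj : rel vertex;
  adj_sym : symmetric adj;
  adj_irrefl : irreflexive adj }.

Definition edges (G : sgraph) : {set {set G}} :=
  [set [set u.1; u.2] | u : G * G & adj u.1 u.2].

Definition connected (G : sgraph) : Prop :=
  0 < #|G| /\ forall x y : G, connect (@adj G) x y.

Definition isomorphic (G H : sgraph) : Prop :=
  exists2 f : G -> H, bijective f & {mono f : x y / adj x y}.

Definition bip_adj (m n : nat) (x y : 'I_m + 'I_n) : bool :=
  match x, y with
  | inl _, inr _ | inr _, inl _ => true
  | _, _ => false
  end.

Lemma bip_adj_sym m n : symmetric (@bip_adj m n).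
Proof. by case=> [x|x] [y|y]. Qed.

Lemma bip_adj_irrefl m n : irreflexive (@bip_adj m n).
Proof. by case. Qed.

Definition complete_bipartite (m n : nat) : sgraph :=
  SGraph (@bip_adj_sym m n) (@bip_adj_irrefl m n).

Definition is_star (G : sgraph) : Prop :=
  exists n : nat, isomorphic G (complete_bipartite 1 n).

Definition is_automorphism (G : sgraph) (s : {perm G}) : Prop :=
  {mono s : x y / adj x y}.

Definition edge_transitive (G : sgraph) : Prop :=
  forall e f : {set G}, e \in edges G -> f \in edges G ->
    exists2 s : {perm G}, is_automorphism s & s @: e = f.

(* A vertex set together with a set of edges, each edge being a two-element
   vertex set. That the edges lie in [edges G] and have their ends in the
   vertex set is not imposed here; it holds for the subgraphs of paths and
   cycles below. *)
Record subgraph (G : sgraph) := Subgraph {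
  sverts : {set G};
  sedges : {set {set G}} }.

Definition whole (G : sgraph) : subgraph G := Subgraph [set: G] (edges G).

Definition is_subgraph (G : sgraph) (H K : subgraph G) : Prop :=
  sverts H \subset sverts K /\ sedges H \subset sedges K.

Definition is_induced_subgraph (G : sgraph) (H K : subgraph G) : Prop :=
  sverts H \subset sverts K /\
  sedges H = [set e in sedges K | e \subset sverts H].

(* [p] is [:: x_0; ...; x_l]: a path of length l has l + 1 vertices. *)
Definition is_path (G : sgraph) (l : nat) (p : seq G) : Prop :=
  [/\ size p = l.+1, uniq p & sorted (@adj G) p].

(* [c] is [:: x_0; ...; x_(l-1)], the final x_l = x_0 being omitted; [cycle]
   includes the adjacency of x_(l-1) and x_0. *)
Definition is_cycle (G : sgraph) (c : seq G) : Prop :=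
  [/\ 3 <= size c, uniq c & cycle (@adj G) c].

(* [zip p (behead p)] lists the pairs (x_i, x_(i+1)) of consecutive vertices;
   [zip c (rot 1 c)] does so cyclically. *)
Definition path_subgraph (G : sgraph) (p : seq G) : subgraph G :=
  Subgraph [set x in p] [set [set u.1; u.2] | u in zip p (behead p)].

Definition cycle_subgraph (G : sgraph) (c : seq G) : subgraph G :=
  Subgraph [set x in c] [set [set u.1; u.2] | u in zip c (rot 1 c)].

Definition is_induced_path (G : sgraph) (l : nat) (p : seq G) : Prop :=
  is_path l p /\ is_induced_subgraph (path_subgraph p) (whole G).

Definition is_induced_cycle (G : sgraph) (c : seq G) : Prop :=
  is_cycle c /\ is_induced_subgraph (cycle_subgraph c) (whole G).

Definition closes_to_induced_cycle (G : sgraph) (p : seq G) : Prop :=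
  exists2 c : seq G, is_induced_cycle c &
    is_induced_subgraph (path_subgraph p) (cycle_subgraph c).

(* Main.v *)
Require Import Defs.
From mathcomp Require Import all_boot perm zify ssralg zmodp.
Set Implicit Arguments.
Unset Strict Implicit.
Unset Printing Implicit Defensive.

(** Let [x0 x1 x2 x3] be an induced path. It closes to an induced cycle as soon as
    some component of [G - N[x1 x2]] is adjacent to both [x0] and [x3]. Otherwise,
    let [a] be the largest size of a component adjacent to [x0] or [x3], say to
    [x0]. Components larger than [a] are adjacent to neither end, hence survive in
    [G - N[x2 x3]], where moreover [x0] lies in a component larger than [a]. So
    strictly more vertices lie in components larger than [a] for the edge [x2 x3]
    than for [x1 x2], contradicting edge-transitivity. An induced path of length 2
    that extends to no induced path of length 3 or 4-cycle forces two distinct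
    degrees along edges and a leaf, hence a star; lengths 1 and 0 follow.

    Conversely, no induced cycle contains an induced path [x0 x1 ...] all of whose
    possible continuations at [x0] are adjacent to interior vertices of the path.
    For length 4 this happens for [0 1 2 6 7] in the Paley graph on 13 vertices;
    for length at least 5, in the incidence graph of the points and the 3-subsets
    of a large enough set, starting from a block whose two other points lie in
    later blocks of the path. *)

(** * Induced paths and cycles *)

Section InducedSubgraphs.

Variable G : sgraph.
Implicit Types (x y z : G) (p c s : seq G) (Z : seq (G * G)).

Lemma adj_neq x y : adj x y -> x != y.
Proof. by apply: contraTneq => ->; rewrite adj_irrefl. Qed.

Lemma eq_set2 x y u v : [set x; y] = [set u; v] ->
  (x, y) = (u, v) \/ (x, y) = (v, u).
Proof.
move=> exy.
have: x \in [set u; v] by rewrite -exy set21.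
have: y \in [set u; v] by rewrite -exy set22.
have: u \in [set x; y] by rewrite exy set21.
have: v \in [set x; y] by rewrite exy set22.
rewrite !inE.
by do 4![move=> /orP[] /eqP ?]; subst; auto.
Qed.

Lemma mem_edges x y : ([set x; y] \in edges G) = adj x y.
Proof.
apply/imsetP/idP => [[[u v]]|xy]; last by exists (x, y); rewrite ?inE.
by rewrite inE /= => uv /eq_set2[] [-> ->] //; rewrite adj_sym.
Qed.

(** Path and cycle subgraphs both take their edges from a list of ordered pairs, so one criterion
    serves both. An edge has no orientation, hence the two alternatives. *)
Lemma pairs_inducedP (V : {set G}) Z :
  {in Z, forall u, [/\ u.1 \in V, u.2 \in V & adj u.1 u.2]} ->
  is_induced_subgraph (Subgraph V [set [set u.1; u.2] | u in Z]) (whole G) <->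
  {in V &, forall x y, adj x y -> (x, y) \in Z \/ (y, x) \in Z}.
Proof.
move=> Zok; split=> [[_ /= eE] x y Vx Vy xy | chordless].
  have: [set x; y] \in [set e in edges G | e \subset V].
    by rewrite inE mem_edges xy subUset !sub1set Vx Vy.
  rewrite -eE => /imsetP[[u v] /= Zuv] /eq_set2[] [-> ->]; auto.
split=> /=; first exact: subsetT.
apply/setP=> e; rewrite inE; apply/imsetP/andP => [[u Zu ->] | []].
  by have [V1 V2 a12] := Zok u Zu; rewrite mem_edges subUset !sub1set V1 V2.
case/imsetP=> [[x y]]; rewrite inE /= => xy ->.
rewrite subUset !sub1set => /andP[Vx Vy].
by have [Zxy|Zyx] := chordless x y Vx Vy xy;
  [exists (x, y) | exists (y, x) => //=; rewrite setUC].
Qed.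

Lemma zip_behead_adj p : sorted (@adj G) p ->
  {in zip p (behead p), forall u,
    [/\ u.1 \in [set x in p], u.2 \in [set x in p] & adj u.1 u.2]}.
Proof.
case: p => // x p; elim: p x => // y p IHp x /= /andP[xy yp] u.
rewrite inE => /orP[/eqP-> | ]; first by rewrite /= !inE !eqxx orbT.
by move/(IHp y yp); rewrite !inE => -[-> -> ->]; rewrite !orbT.
Qed.

Lemma zip_rot1_adj c : cycle (@adj G) c ->
  {in zip c (rot 1 c), forall u,
    [/\ u.1 \in [set x in c], u.2 \in [set x in c] & adj u.1 u.2]}.
Proof.
case: c => // x c; rewrite rot1_cons => xc u.
(* Cyclic pairs are the consecutive pairs of the closed walk [x :: rcons c x], which reduces the
   claim to paths. *)
have -> : zip (x :: c) (rcons c x) =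
          zip (x :: rcons c x) (behead (x :: rcons c x)).
  rewrite /= -rcons_cons.
  have: size (x :: c) = size (rcons c x) by rewrite size_rcons.
  by elim: (rcons c x) (x :: c) => [|z t IHt] [|y s] // [/IHt/= ->].
by move/(zip_behead_adj (p := x :: rcons c x) xc);
  rewrite !inE !mem_rcons !inE !orbA !orbb.
Qed.

(* [head x p'] is the default value [x] when [p'] is empty; the condition is then
   vacuous. *)
Fixpoint chordless p : bool :=
  if p is x :: p' then
    [&& x \notin p', all (fun y => adj x y == (y == head x p')) p'
      & chordless p']
  else true.

Lemma chordless_sorted p : chordless p -> sorted (@adj G) p.
Proof.
case: p => // x p; elim: p x => // y p IHp x /and3P[_ /= /andP[/eqP xy _] yp].
by rewrite xy eqxx; apply: IHp.
Qed.

Lemma chordless_uniq p : chordless p -> uniq p.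
Proof. by elim: p => //= x p IHp /and3P[-> _ /IHp->]. Qed.

Lemma chordless_catr p s : chordless (p ++ s) -> chordless s.
Proof. by elim: p => //= x p IHp /and3P[_ _ /IHp]. Qed.

Lemma chordless_chord p : chordless p ->
  {in p &, forall x y, adj x y ->
    (x, y) \in zip p (behead p) \/ (y, x) \in zip p (behead p)}.
Proof.
elim: p => // z p IHp /and3P[_ /allP /= z_p /IHp{}IHp] x y.
have sub u : u \in zip p (behead p) -> u \in zip (z :: p) p.
  by case: p {z_p IHp} => //= v p; rewrite !inE => ->; rewrite orbT.
have Ez u : u \in p -> adj z u -> (z, u) \in zip (z :: p) p.
  move=> pu zu; move: (z_p u pu); rewrite zu => /eqP/esym/eqP->.
  by case: p pu {z_p IHp sub} => //= v p _; rewrite mem_head.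
rewrite !inE => /orP[/eqP->|px] /orP[/eqP->|py]; rewrite ?adj_irrefl //.
- by move/(Ez y py); left.
- by rewrite adj_sym => /(Ez x px); right.
by case/(IHp _ _ px py) => /sub; [left | right].
Qed.

Lemma chordless_induced_path l p : size p = l.+1 -> chordless p ->
  is_induced_path l p.
Proof.
move=> szp cp; have sp := chordless_sorted cp.
split; first by split=> //; apply: chordless_uniq.
apply/pairs_inducedP; first exact: zip_behead_adj.
by move=> x y; rewrite !inE; apply: chordless_chord.
Qed.

Lemma induced_path_chordless l p : is_induced_path l p -> chordless p.
Proof.
case=> -[_ up sp] /pairs_inducedP; move/(_ (zip_behead_adj sp)) => ch.
have {ch} : {in p &, forall x y, adj x y ->
    (x, y) \in zip p (behead p) \/ (y, x) \in zip p (behead p)}.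
  by move=> x y px py; apply: ch; rewrite inE.
elim: p up sp => // x [|y p] IHp //= /andP[xNp up] /andP[xy sp] ch.
have Nzip u v : (u, v) \in zip (y :: p) p -> (u != x) && (v != x).
  move/(zip_behead_adj (p := y :: p) sp); rewrite !inE /= -!in_cons => -[pu pv _].
  by rewrite (memPn xNp _ pu) (memPn xNp _ pv).
have tail u : u \in y :: p -> u \in [:: x, y & p].
  by move=> pu; rewrite in_cons pu orbT.
rewrite xNp eqxx xy /=; apply/andP; split; last first.
  apply: IHp => // u v pu pv uv.
  case: (ch u v (tail u pu) (tail v pv) uv); rewrite in_cons; case/orP=> [/eqP[]|].
  - by move=> eu _; rewrite eu (negPf xNp) in pu.
  - by left.
  - by move=> ev _; rewrite ev (negPf xNp) in pv.
  by right.
apply/allP=> z pz; case: (z =P y) => [->|/eqP zy]; first by rewrite xy.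
rewrite eqbF_neg; apply/negP => xz.
have pz' : z \in [:: x, y & p] by rewrite !inE pz !orbT.
case: (ch x z (mem_head _ _) pz' xz); rewrite in_cons xpair_eqE.
  by rewrite (negPf zy) andbF /= => /Nzip; rewrite eqxx.
by rewrite eq_sym (negPf (adj_neq xz)) /= => /Nzip; rewrite eqxx andbF.
Qed.

Lemma chordless_nth x0 p : uniq p ->
  (forall i j, i < j -> j < size p ->
     adj (nth x0 p i) (nth x0 p j) = (j == i.+1)) ->
  chordless p.
Proof.
elim: p => //= x p IHp /andP[xNp up] nth_adj; rewrite xNp IHp //; last first.
  by move=> i j ij jp; apply: (nth_adj i.+1 j.+1).
rewrite andbT; apply/allP=> y /(nthP x0)[j jp <-].
have /= -> := nth_adj 0 j.+1 isT jp.
rewrite eqSS; case: p jp up {IHp xNp nth_adj} => //= z p jp /andP[zNp _].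
case: j jp => [|j] jp /=; first by rewrite !eqxx.
by rewrite (negPf (memPn zNp _ (mem_nth x0 jp))).
Qed.

Lemma chordless_adj x0 p i j : chordless p -> i < j -> j < size p ->
  adj (nth x0 p i) (nth x0 p j) = (j == i.+1).
Proof.
elim: p i j => //= x p IHp [|i] [|j] //= /and3P[xNp x_p cp] ij jp; last first.
  by rewrite IHp.
move/allP/(_ _ (mem_nth x0 jp))/eqP: x_p => ->.
case: p jp cp {IHp xNp} => //= y p; case: j {ij} => [|j] jp /and3P[yNp _ _] /=.
  by rewrite !eqxx.
by rewrite (negPf (memPn yNp _ (mem_nth x0 jp))).
Qed.

(** A chord would lie within [p] or start at [a], and both are excluded. Every induced cycle
    constructed below arises in this way. *)
Lemma chordless_cycle a p : 1 < size p -> chordless p -> a \notin p ->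
  {in p, forall x, adj a x = (x == head a p) || (x == last a p)} ->
  is_induced_cycle (a :: p).
Proof.
move=> sz cp aNp a_p.
have c_ap : cycle (@adj G) (a :: p).
  rewrite /= rcons_path; have := chordless_sorted cp.
  case: p sz cp aNp a_p => // b p sz cp aNp a_p /= ->.
  by rewrite a_p ?mem_head //= eqxx adj_sym a_p ?mem_last //= eqxx orbT.
split; first by split=> //=; rewrite aNp chordless_uniq.
apply/pairs_inducedP; first exact: zip_rot1_adj.
rewrite rot1_cons.
have sub u : u \in zip p (behead p) -> u \in zip (a :: p) (rcons p a).
  case: p {sz cp aNp a_p c_ap} => //= b p.
  rewrite inE => up; apply/orP; right.
  elim: p b up => //= d p IHp b; rewrite !inE => /orP[->//|/IHp->].
  by rewrite orbT.
have Ea x : x \in p -> adj a x ->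
    (a, x) \in zip (a :: p) (rcons p a) \/ (x, a) \in zip (a :: p) (rcons p a).
  move=> px; rewrite (a_p x px) => /orP[] /eqP->.
    by left; case: p px {sz cp aNp a_p c_ap sub} => //= b p _; rewrite mem_head.
  right; case: p px {sz cp aNp a_p c_ap sub} => //= b p _.
  rewrite inE; apply/orP; right.
  elim: p b => /= [|d p IHp] b; first by rewrite mem_head.
  by rewrite inE IHp orbT.
move=> x y; rewrite !inE => /orP[/eqP->|px] /orP[/eqP->|py].
- by rewrite adj_irrefl.
- exact: Ea.
- by rewrite adj_sym => /(Ea x px)[]; [right | left].
by case/(chordless_chord cp px py) => /sub; [left | right].
Qed.

Lemma split_last (a : pred G) s : has a s ->
  exists s1 x s2, [/\ s = s1 ++ x :: s2, a x & ~~ has a s2].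
Proof.
elim: s => //= x s IHs; have [/IHs[s1 [y [s2 [-> ay Nas2]]]] _|Nas] := boolP (has a s).
  by exists (x :: s1), y, s2.
by rewrite orbF => ax; exists [::], x, s.
Qed.

(** Shorten the tail first. If [x] already occurs on the result, start from there; otherwise jump
    from [x] to its last neighbour on it. No new vertices appear, so a path can be kept inside a
    component. *)
Lemma path_chordless x p : path (@adj G) x p ->
  exists q, [/\ chordless (x :: q), last x q = last x p & {subset q <= p}].
Proof.
elim: p x => [|z p IHp] x; first by exists [::].
case/andP=> xz /IHp[q [cq lq sq]].
have {}sq : {subset z :: q <= z :: p}.
  by move=> y; rewrite !inE => /orP[->//|/sq->]; rewrite orbT.
have [xq | xNq] := boolP (x \in z :: q).
  have [s1 [s2 E]] : exists s1 s2, z :: q = s1 ++ x :: s2.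
    by case/splitPr: xq => s1 s2; exists s1, s2.
  exists s2; split.
  - by apply: (@chordless_catr s1); rewrite -E.
  - by rewrite /= -lq -[last z q]/(last x (z :: q)) E last_cat.
  by move=> y s2y; apply: sq; rewrite E mem_cat inE s2y !orbT.
have [|s1 [u [s2 [E xu xNs2]]]] := @split_last (@adj G x) (z :: q).
  by rewrite /= xz.
exists (u :: s2); split.
- have cu : chordless (u :: s2) by apply: (@chordless_catr s1); rewrite -E.
  rewrite -[chordless _]/[&& _, _ & chordless (u :: s2)] cu andbT /= xu eqxx /=.
  apply/andP; split; first by move: xNq; rewrite E mem_cat negb_or => /andP[].
  apply/allP=> y s2y; rewrite (negPf (hasPn xNs2 y s2y)) eq_sym eqbF_neg.
  by case/andP: cu => uNs2 _; apply: (memPn uNs2).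
- by rewrite /= -lq -[last z q]/(last x (z :: q)) E last_cat.
by move=> y uy; apply: sq; rewrite E mem_cat uy orbT.
Qed.

End InducedSubgraphs.

(** * Induced paths of length 3 *)

Section ClosingPaths.

Variable G : sgraph.
Implicit Types (x y z : G) (p c s : seq G) (A B : {set G}).

(** Containment of vertices is enough: the edges of induced paths and cycles are determined by their
    vertices. This form also passes to sublists. *)
Definition on_induced_cycle s :=
  exists2 c, is_induced_cycle c & {subset s <= c}.

Lemma on_induced_cycle_closes l p :
  is_induced_path l p -> on_induced_cycle p -> closes_to_induced_cycle p.
Proof.
case=> _ [_ /= Ep] [c cc pc]; exists c => //; have [_ [_ /= Ec]] := cc.
have pc' : [set x in p] \subset [set x in c].
  by apply/subsetP=> x; rewrite !inE => /pc.
split=> //=; rewrite Ep Ec; apply/setP=> e; rewrite !inE -andbA; congr (_ && _).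
by apply/idP/andP=> [ep|[]//]; split=> //; apply: subset_trans ep pc'.
Qed.

(** * Components of induced subgraphs *)

Definition restr A : rel G := [rel x y | [&& x \in A, y \in A & adj x y]].

Definition component A x := [set y | connect (restr A) x y].

Lemma component_sub A x : x \in A -> component A x \subset A.
Proof.
move=> Ax; apply/subsetP=> y; rewrite inE => /connectP[p].
by elim/last_ind: p y => [|p z _] y; rewrite ?rcons_path ?last_rcons;
  [move=> _ -> | case/andP=> _ /and3P[_ Az _] ->].
Qed.

(** A walk from [x] inside [A] never leaves the component of [x], so it is also a walk inside [B].
    This covers sets [A] that do not lie in [B] as a whole. *)
Lemma componentS A B x :
  component A x \subset B -> component A x \subset component B x.
Proof.
move=> sAB; apply/subsetP=> y; rewrite inE => /connectP[p].
elim/last_ind: p y => [|p z IHp] y; first by move=> _ ->; rewrite inE.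
rewrite rcons_path last_rcons => /andP[xp pz] ->.
have := IHp _ xp erefl; rewrite !inE => xl; apply: connect_trans xl (connect1 _).
have lA : last x p \in component A x by rewrite inE; apply/connectP; exists p.
have zA : z \in component A x.
  by move: lA; rewrite !inE => lA; apply: connect_trans lA (connect1 pz).
by case/and3P: pz => _ _ pz; rewrite /restr /= pz (subsetP sAB _ lA) (subsetP sAB _ zA).
Qed.

(** The vertices of $G - N[xy]$, for an edge $xy$. *)
Definition far x y :=
  [set z | [&& z != x, z != y, ~~ adj x z & ~~ adj y z]].

(** Its cardinality is the invariant of edges that is compared along the path. *)
Definition in_large x y k :=
  [set z in far x y | k < #|component (far x y) z|].

Lemma farC x y : far x y = far y x.
Proof. by apply/setP=> z; rewrite !inE; do !bool_congr. Qed.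

Lemma in_largeC x y k : in_large x y k = in_large y x k.
Proof. by rewrite /in_large farC. Qed.

Lemma far_automorphism (s : {perm G}) x y z : is_automorphism s ->
  (s z \in far (s x) (s y)) = (z \in far x y).
Proof. by move=> aut; rewrite !inE !aut !(inj_eq perm_inj). Qed.

Lemma component_automorphism (s : {perm G}) x y z : is_automorphism s ->
  s @: component (far x y) z \subset component (far (s x) (s y)) (s z).
Proof.
move=> aut; apply/subsetP=> _ /imsetP[t + ->]; rewrite !inE => /connectP[p].
elim/last_ind: p t => [|p u IHp] t; first by move=> _ ->.
rewrite rcons_path last_rcons => /andP[zp pu] ->.
apply: connect_trans (IHp _ zp erefl) (connect1 _).
by move: pu; rewrite /restr /= aut !far_automorphism.
Qed.

(** An automorphism between the edges carries each component into one at least as large. It may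
    reverse the edge, which [in_largeC] absorbs. *)
Lemma leq_in_large x y x' y' k : edge_transitive G -> adj x y -> adj x' y' ->
  #|in_large x y k| <= #|in_large x' y' k|.
Proof.
move=> et xy xy'.
have [|| s aut] := et [set x; y] [set x'; y']; rewrite ?mem_edges //.
rewrite imsetU1 imset_set1 => sE.
have -> : in_large x' y' k = in_large (s x) (s y) k.
  by case: (eq_set2 sE) => -[-> ->] //; rewrite in_largeC.
rewrite -(card_imset _ (@perm_inj _ s)); apply/subset_leq_card/subsetP=> _ /imsetP[z + ->].
rewrite inE => /andP[zf kz]; rewrite inE far_automorphism // zf /=.
apply: leq_trans kz _; rewrite -(card_imset _ (@perm_inj _ s)).
exact/subset_leq_card/component_automorphism.
Qed.

Lemma restr_sym A : connect_sym (restr A).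
Proof.
by apply: sym_connect_sym => x y; rewrite /restr /= adj_sym; do !bool_congr.
Qed.

Lemma component_refl A x : x \in component A x.
Proof. by rewrite inE. Qed.

Lemma eq_component A x y : y \in component A x -> component A x = component A y.
Proof.
rewrite inE => xy; apply/setP=> z; rewrite !inE.
exact: same_connect (restr_sym A) _ _ xy _.
Qed.

Definition attached x A := [exists y in A, adj x y].

Section InducedPathOfLength3.

Variables x0 x1 x2 x3 : G.
Hypothesis path03 : chordless [:: x0; x1; x2; x3].

Lemma chordless4_adj :
  [/\ adj x0 x1, adj x1 x2 & adj x2 x3] /\
  [/\ adj x0 x2 = false, adj x0 x3 = false & adj x1 x3 = false].
Proof.
have adjE i j : i < j -> j < 4 -> _ := chordless_adj x0 path03.
by split; split; [apply: (adjE 0 1) | apply: (adjE 1 2) | apply: (adjE 2 3)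
  | apply: (adjE 0 2) | apply: (adjE 0 3) | apply: (adjE 1 3)].
Qed.

Lemma start_far : x0 \in far x2 x3.
Proof.
have [_ [a02 a03 _]] := chordless4_adj.
rewrite inE [adj x2 _]adj_sym [adj x3 _]adj_sym a02 a03 !andbT.
by have /and3P[+ _ _] := path03; rewrite !inE !negb_or => /and3P[_ -> ->].
Qed.

Lemma start_not_far : x0 \notin far x1 x2.
Proof.
have [[a01 _ _] _] := chordless4_adj.
by rewrite inE [adj x1 _]adj_sym a01 !andbF.
Qed.

(** Vertices of the component avoid [x2] and its neighbours, in particular [x3]; not being attached
    to [x3] excludes the rest of $N[x_2x_3]$. *)
Lemma unattached_component_far z : z \in far x1 x2 ->
  ~~ attached x3 (component (far x1 x2) z) ->
  component (far x1 x2) z \subset far x2 x3.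
Proof.
have [[_ _ a23] _] := chordless4_adj.
move=> fz /exists_inPn Nx3; apply/subsetP=> y zy.
have := subsetP (component_sub fz) y zy.
rewrite !inE => /and4P[_ -> _ yx2] /=; rewrite yx2 (Nx3 y zy) !andbT.
by apply: contraNneq yx2 => ->.
Qed.

(** Components larger than [a] survive when the edge moves to [x2 x3], and [x0], a neighbour of
    [x1], is counted only afterwards. *)
Lemma in_large_proper a :
  {in far x1 x2, forall z, a < #|component (far x1 x2) z| ->
     ~~ attached x3 (component (far x1 x2) z)} ->
  a < #|component (far x2 x3) x0| ->
  in_large x1 x2 a \proper in_large x2 x3 a.
Proof.
move=> large_x3 lt_a; apply/properP; split; last first.
  by exists x0; rewrite inE ?start_far ?(negPf start_not_far).
apply/subsetP=> z; rewrite inE => /andP[fz az].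
have sub := unattached_component_far fz (large_x3 z fz az).
rewrite inE (subsetP sub _ (component_refl _ _)).
by apply: leq_trans az (subset_leq_card (componentS sub)).
Qed.

(** The component survives in [far x2 x3] and gains at least the vertex [x0]. *)
Lemma component_grows z : z \in far x1 x2 ->
  attached x0 (component (far x1 x2) z) ->
  ~~ attached x3 (component (far x1 x2) z) ->
  #|component (far x1 x2) z| < #|component (far x2 x3) x0|.
Proof.
move=> fz /exists_inP[y zy x0y] Nx3.
have sub := unattached_component_far fz Nx3.
have x0z : x0 \in component (far x2 x3) z.
  have := subsetP (componentS sub) y zy; rewrite !inE => zy'.
  apply: connect_trans zy' (connect1 _).
  by rewrite /restr /= start_far (subsetP sub _ zy) adj_sym.
rewrite -(eq_component x0z); apply/proper_card/properP.
split; first exact: componentS.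
exists x0 => //; apply/negP=> /(subsetP (component_sub fz)).
exact/negP/start_not_far.
Qed.

(** An induced path from [x3] to [x0] with interior in the component meets the neighbourhoods of
    [x1] and [x2] only in its ends, so [x1] and [x2] complete it to an induced cycle. *)
Lemma attached_both_on_induced_cycle z : z \in far x1 x2 ->
  attached x0 (component (far x1 x2) z) ->
  attached x3 (component (far x1 x2) z) ->
  on_induced_cycle [:: x0; x1; x2; x3].
Proof.
have [[a01 a12 a23] [a02 a03 a13]] := chordless4_adj.
move=> fz /exists_inP[u zu x0u] /exists_inP[v zv x3v].
have: connect (restr (far x1 x2)) v u.
  by move: zu; rewrite (eq_component zv) inE.
case/connectP=> q vq uq.
(* The walk from [x3] to [v], through the component to [u], then to [x0], is shortened to an induced
   path. *)
have [|p [cp lp sp]] := @path_chordless G x3 (v :: rcons q x0).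
  rewrite /= x3v rcons_path -uq [adj u _]adj_sym x0u andbT.
  by apply: sub_path vq => s t /and3P[].
have {}lp : last x3 p = x0 by rewrite lp /= last_rcons.
have p_far y : y \in p -> y = x0 \/ y \in far x1 x2.
  move/sp; rewrite inE mem_rcons inE => /or3P[/eqP->|/eqP->|qy]; auto; right.
    exact: (subsetP (component_sub fz)).
  have vfar : v \in far x1 x2 by apply: (subsetP (component_sub fz)).
  elim: q (v) vq qy {uq sp} => //= w q IHq v' /andP[/and3P[_ fw _] wq].
  by rewrite inE => /orP[/eqP->//|]; apply: IHq wq.
have := chordless_uniq path03; rewrite /= !inE !negb_or.
case/and3P=> /and3P[n01 n02 n03] /andP[n12 n13] _.
have x1_p y : y \in p -> (adj x1 y = (y == x0)) * (y != x1).
  move/p_far=> [->|]; first by rewrite adj_sym a01 eqxx.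
  rewrite inE => /and4P[yx1 _ /negPf Nx1y _]; rewrite Nx1y; split=> //.
  by apply/esym/negbTE/eqP=> y0; rewrite y0 adj_sym a01 in Nx1y.
have x2_p y : y \in p -> (adj x2 y = false) * (y != x2).
  move/p_far=> [->|]; first by rewrite adj_sym a02.
  by rewrite inE => /and4P[_ -> _ /negPf].
have x0p : x0 \in p.
  case: p lp {cp sp p_far x1_p x2_p} => [/esym/eqP|y p /= <-]; last exact: mem_last.
  by rewrite (negPf n03).
exists [:: x1, x2, x3 & p]; last first.
  by move=> y; rewrite !inE => /or4P[] /eqP->; rewrite ?x0p ?eqxx ?orbT.
apply: chordless_cycle => //.
- rewrite -[chordless _]/[&& _, _ & chordless (x3 :: p)] cp andbT /= a23 eqxx /=.
  rewrite inE negb_or (adj_neq a23) /=; apply/andP; split.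
    by apply/negP=> /x2_p; rewrite eqxx => -[].
  apply/allP=> y py; rewrite x2_p // eq_sym eqbF_neg.
  by case/andP: cp => /memPn/(_ y py).
- rewrite !inE !negb_or n12 n13 /=.
  by apply/negP=> /x1_p; rewrite eqxx => -[].
move=> y; rewrite /= lp !inE => /or3P[/eqP->|/eqP->|py].
- by rewrite a12 eqxx.
- by rewrite a13 eq_sym (negPf (adj_neq a23)) eq_sym (negPf n03).
by rewrite x1_p // (negPf (x2_p y py).2).
Qed.

End InducedPathOfLength3.

Lemma chordless_rev4 x0 x1 x2 x3 :
  chordless [:: x0; x1; x2; x3] -> chordless [:: x3; x2; x1; x0].
Proof.
move=> p03; have := chordless_uniq p03.
have [[a01 a12 a23] [a02 a03 a13]] := chordless4_adj p03.
rewrite -rev_uniq => u30; apply: (@chordless_nth _ x0) => //.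
by move=> [|[|[|[|i]]]] [|[|[|[|j]]]] //= _ _; rewrite adj_sym.
Qed.

Lemma induced_path3_on_induced_cycle x0 x1 x2 x3 : edge_transitive G ->
  chordless [:: x0; x1; x2; x3] -> on_induced_cycle [:: x0; x1; x2; x3].
Proof.
move=> et p03; have p30 := chordless_rev4 p03.
have [[a01 a12 a23] _] := chordless4_adj p03.
pose K := component (far x1 x2).
have [/exists_inP[z fz /andP[]]|/exists_inPn Nboth] :=
  boolP [exists z in far x1 x2, attached x0 (K z) && attached x3 (K z)].
  exact: attached_both_on_induced_cycle.
(* [a] is the size of the largest component attached to an end of the path; the
   end it is attached to enters a component of size more than [a] when the edge
   [x1 x2] is replaced by the edge at the other end. *)
exfalso; pose att := [pred z | z \in far x1 x2 & attached x0 (K z) || attached x3 (K z)].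
pose a := \max_(z | att z) #|K z|.
have large_unattached : {in far x1 x2, forall z, a < #|K z| ->
    ~~ attached x0 (K z) && ~~ attached x3 (K z)}.
  move=> z fz az; rewrite -negb_or; apply: contraTN az => Az.
  by rewrite -leqNgt (@leq_bigmax_cond _ att) //= fz.
have lt_x0 : ~ a < #|component (far x2 x3) x0|.
  move=> lt_a; have := leq_in_large a et a23 a12; apply/negP; rewrite -ltnNge.
  apply/proper_card/(in_large_proper p03) => // z fz az.
  by case/andP: (large_unattached z fz az).
have lt_x3 : ~ a < #|component (far x1 x0) x3|.
  rewrite adj_sym in a01; rewrite adj_sym in a12.
  move=> lt_a; have := leq_in_large a et a01 a12; apply/negP; rewrite -ltnNge.
  apply/proper_card/(in_large_proper p30) => // z; rewrite farC => fz az.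
  by case/andP: (large_unattached z fz az).
(* With nothing attached, [a] is an empty maximum, hence 0, and the component of [x0] already
   exceeds it. *)
have [z0 att0 | no_att] := pickP att; last first.
  by apply: lt_x0; rewrite /a big_pred0 //; apply/card_gt0P; exists x0; rewrite inE.
have [|z /andP[fz att_z] az] := @eq_bigmax_cond _ att (fun z => #|K z|).
  by apply/card_gt0P; exists z0.
have := Nboth z fz; rewrite negb_and; case/orP: att_z => att_z; rewrite att_z //= ?orbF.
  by move=> Natt; apply: lt_x0; rewrite /a az; apply: component_grows.
move=> Natt; apply: lt_x3; rewrite /a az /K farC.
by apply: component_grows; rewrite // farC.
Qed.

End ClosingPaths.

(** * Shorter induced paths *)

Section ShortPaths.

Variable G : sgraph.
Implicit Types (c x y z : G) (p s : seq G) (A : {set G}).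

Definition degree x := #|[set y | adj x y]|.

Lemma degree_automorphism (s : {perm G}) x :
  is_automorphism s -> degree (s x) = degree x.
Proof.
move=> aut; rewrite /degree -(card_imset [set y | adj x y] (@perm_inj _ s)).
apply: eq_card => y; rewrite inE; apply/idP/imsetP => [xy|[z + ->]]; last first.
  by rewrite inE aut.
by exists (s^-1%g y); rewrite ?permKV // inE -aut permKV.
Qed.

Lemma edge_transitive_degree x y x' y' :
    edge_transitive G -> adj x y -> adj x' y' ->
  degree x' = degree x /\ degree y' = degree y \/
  degree x' = degree y /\ degree y' = degree x.
Proof.
move=> et xy xy'.
have [|| s aut] := et [set x; y] [set x'; y']; rewrite ?mem_edges //.
rewrite imsetU1 imset_set1 -(degree_automorphism x aut) -(degree_automorphism y aut).
by move/eq_set2=> -[] [-> ->]; auto.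
Qed.

Lemma connected_closed A x : connected G -> x \in A ->
  (forall y z, y \in A -> adj y z -> z \in A) -> forall y, y \in A.
Proof.
case=> _ conn Ax clA y; have /connectP[p] := conn x y.
elim: p x Ax => [|z p IHp] x Ax /=; first by move=> _ ->.
by case/andP=> xz zp; apply: IHp zp; apply: clA xz.
Qed.

(** The leaves are numbered by enumerating the complement of [c]. A single vertex is included, as
    $K_{1,0}$. *)
Lemma star_with_center c : (forall x, x != c -> adj c x) ->
  (forall x y, x != c -> y != c -> ~~ adj x y) -> is_star G.
Proof.
move=> c_adj leaves; exists #|[set~ c]|.
pose f x : complete_bipartite 1 #|[set~ c]| :=
  if insub x : {? y | y \in [set~ c]} is Some u
  then inr (enum_rank_in (valP u) (val u)) else inl ord0.
pose g (u : complete_bipartite 1 #|[set~ c]|) : G :=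
  if u is inr i then enum_val i else c.
have fc : f c = inl ord0.
  by rewrite /f; case: insubP => // u; rewrite !inE eqxx.
have fx x : x != c -> exists2 i, f x = inr i & enum_val i = x.
  move=> xc; rewrite /f; case: insubP => [u _ ux|]; last by rewrite !inE xc.
  by eexists; [reflexivity | rewrite enum_rankK_in ?(valP u)].
exists f; first exists g.
- move=> x; have [->|/fx[i ->]] := eqVneq x c; first by rewrite fc.
  by [].
- case=> [i|i] /=; first by rewrite fc (ord1 i).
  have /fx[j -> /enum_val_inj->//] : enum_val i != c.
  by have := enum_valP i; rewrite in_setC1.
move=> x y; have [->|xc] := eqVneq x c; have [->|yc] := eqVneq y c.
- by rewrite !adj_irrefl.
- by have [i -> _] := fx y yc; rewrite fc (c_adj y yc).
- by have [i -> _] := fx x xc; rewrite fc [RHS]adj_sym (c_adj x xc).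
have [i -> _] := fx x xc; have [j -> _] := fx y yc.
by rewrite (negPf (leaves _ _ xc yc)).
Qed.

Lemma on_induced_cycleS s t : {subset s <= t} ->
  on_induced_cycle t -> on_induced_cycle s.
Proof. by move=> st [c cc tc]; exists c => // x /st/tc. Qed.

Hypothesis (conn : connected G) (et : edge_transitive G) (Nstar : ~ is_star G).

Lemma induced_path2_on_induced_cycle x0 x1 x2 :
  chordless [:: x0; x1; x2] -> on_induced_cycle [:: x0; x1; x2].
Proof.
move=> p02; have adjE i j : i < j -> j < 3 -> _ := chordless_adj x0 p02.
have a01 : adj x0 x1 by apply: (adjE 0 1).
have a12 : adj x1 x2 by apply: (adjE 1 2).
have a02 : adj x0 x2 = false by apply: (adjE 0 2).
have := chordless_uniq p02; rewrite /= !inE !negb_or.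
case/and3P=> /andP[n01 n02] n12 _.
have [/existsP[w /and3P[x2w wx1 x1w]]|/existsPn x2_dominated] :=
  boolP [exists w, [&& adj x2 w, w != x1 & ~~ adj x1 w]].
  have wx0 : w != x0 by apply: contraNneq x1w => ->; rewrite adj_sym a01.
  have [x0w|Nx0w] := boolP (adj x0 w).
    exists [:: x0; x1; x2; w]; last first.
      by move=> y; rewrite !inE => /or3P[]/eqP->; rewrite eqxx ?orbT.
    apply: chordless_cycle => //.
    - apply: (@chordless_nth _ x0) => [|[|[|i]] [|[|[|j]]] //= _ _].
        by rewrite /= !inE !negb_or n12 (adj_neq x2w) eq_sym wx1.
      exact: negbTE.
    - by rewrite !inE !negb_or n01 n02 eq_sym.
    move=> y; rewrite /= !inE => /or3P[]/eqP->.
    - by rewrite a01 eqxx.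
    - by rewrite a02 eq_sym (negPf n12) (negPf (adj_neq x2w)).
    by rewrite x0w eqxx orbT.
  apply: (@on_induced_cycleS _ [:: x0; x1; x2; w]).
    by move=> y; rewrite !inE => /or3P[]/eqP->; rewrite eqxx ?orbT.
  apply: induced_path3_on_induced_cycle => //.
  apply: (@chordless_nth _ x0).
    by rewrite /= !inE !negb_or n01 n02 n12 (adj_neq x2w) eq_sym wx0 eq_sym wx1.
  move=> [|[|[|i]]] [|[|[|[|j]]]] //= _ _; exact: negbTE.
exfalso; apply: Nstar.
have x2_nbr w : adj x2 w -> w != x1 -> adj x1 w.
  by move=> x2w wx1; have := x2_dominated w; rewrite x2w wx1 /= negbK.
(* Replacing [x1] by [x2] in the neighbourhood of [x2] keeps its size and puts it inside that of
   [x1], where it misses [x0]. *)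
have lt_deg : degree x2 < degree x1.
  rewrite [degree x2](cardsD1 x1) inE adj_sym a12.
  have {1}-> : true = (x2 \notin [set y | adj x2 y] :\ x1) :> nat.
    by rewrite !inE adj_irrefl andbF.
  rewrite -cardsU1; apply/proper_card/properP; split.
    apply/subsetP=> y; rewrite !inE => /orP[/eqP->//|/andP[yx1 x2y]].
    exact: x2_nbr.
  by exists x0; rewrite !inE ?(adj_sym _ x0) ?a02 ?andbF ?orbF.
(* Another neighbour [w] would also be adjacent to [x1]; the edges [x1 w] and [x2 w] would then
   require [w] to have both of the two distinct degrees. *)
have x2_leaf w : adj x2 w -> w = x1.
  move=> x2w; apply/eqP/contraT => wx1; have x1w := x2_nbr w x2w wx1.
  have := edge_transitive_degree et a12 x2w.
  have := edge_transitive_degree et a12 x1w.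
  by move=> [[? ?]|[? ?]] [[? ?]|[? ?]]; lia.
have deg_x2 : degree x2 = 1.
  apply/eqP/cards1P; exists x1; apply/setP=> w; rewrite !inE.
  by apply/idP/eqP=> [/x2_leaf//|->]; rewrite adj_sym.
(* Every edge has one end of degree 1 and one of degree [degree x1], which exceeds 1; so all
   neighbours of [x1] are leaves. *)
have leaf y z : adj x1 y -> adj y z -> z = x1.
  move=> x1y yz; have deg_y : degree y = 1.
    by case: (edge_transitive_degree et a12 x1y) => -[] *; lia.
  have /cards1P[w Nyw] : degree y == 1 by rewrite deg_y.
  have : z \in [set w] by rewrite -Nyw inE.
  have : x1 \in [set w] by rewrite -Nyw inE adj_sym.
  by rewrite !inE => /eqP-> /eqP.
have spans y : y != x1 -> adj x1 y.
  have: y \in x1 |: [set y | adj x1 y].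
    apply: (connected_closed conn (setU11 _ _)) => u v; rewrite !inE.
    by case/orP=> [/eqP-> ->|x1u /(leaf _ _ x1u)->]; rewrite ?eqxx ?orbT.
  by rewrite !inE => /orP[->|].
apply: star_with_center (spans) _ => y z yx1 zx1.
by apply: contra zx1 => /(leaf y z (spans y yx1))->.
Qed.

(** A further neighbour of either end gives a triangle or an induced path of length 2. Without one,
    the edge is the whole graph, the star $K_{1,1}$. *)
Lemma adj_on_induced_cycle x y : adj x y -> on_induced_cycle [:: x; y].
Proof.
have extend (u v w : G) : adj u v -> adj v w -> w != u -> on_induced_cycle [:: u; v].
  move=> uv vw wu; apply: (@on_induced_cycleS _ [:: u; v; w]).
    by move=> z; rewrite !inE => /orP[]/eqP->; rewrite eqxx ?orbT.
  have [uw|Nuw] := boolP (adj u w); last first.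
    apply: induced_path2_on_induced_cycle; apply: (@chordless_nth _ u).
      by rewrite /= !inE !negb_or (adj_neq uv) (adj_neq vw) eq_sym wu.
    by move=> [|[|i]] [|[|[|j]]] //= _ _; apply: negbTE.
  exists [:: u; v; w] => //; apply: chordless_cycle => //=.
  - by rewrite inE (adj_neq vw) vw eqxx.
  - by rewrite !inE negb_or (adj_neq uv) eq_sym wu.
  by move=> z; rewrite !inE => /orP[]/eqP->; rewrite ?uv ?uw eqxx ?orbT.
move=> xy.
have [/existsP[w /andP[yw wx]]|/existsPn y_leaf] :=
    boolP [exists w, adj y w && (w != x)]; first exact: extend yw wx.
have [/existsP[w /andP[xw wy]]|/existsPn x_leaf] :=
    boolP [exists w, adj x w && (w != y)].
  apply: (@on_induced_cycleS _ [:: y; x]); last by apply: extend xw wy; rewrite adj_sym.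
  by move=> z; rewrite !inE orbC.
exfalso; apply: Nstar.
have two z : (z == x) || (z == y).
  have -> : (z == x) || (z == y) = (z \in [set x; y]) by rewrite !inE.
  apply: (connected_closed conn (set21 x y)) => u v; rewrite !inE.
  case/orP=> /eqP-> uv; first by have := x_leaf v; rewrite uv negbK => ->; rewrite orbT.
  by have := y_leaf v; rewrite uv negbK => ->.
apply: (@star_with_center x) => [z zx|z t zx tx].
  by have := two z; rewrite (negPf zx) => /eqP->.
have := two z; have := two t; rewrite (negPf zx) (negPf tx) => /eqP-> /eqP->.
by rewrite adj_irrefl.
Qed.

Lemma vertex_on_induced_cycle x : on_induced_cycle [:: x].
Proof.
have [/existsP[w xw]|/existsPn Nx] := boolP [exists w, adj x w].
  apply: on_induced_cycleS (adj_on_induced_cycle xw) => y.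
  by rewrite !inE => ->.
exfalso; apply: Nstar.
have one z : z == x.
  have -> : (z == x) = (z \in [set x]) by rewrite inE.
  apply: (connected_closed conn (set11 x)) => u v /set1P-> xv.
  by have := Nx v; rewrite xv.
by apply: (@star_with_center x) => [z|z t]; rewrite one.
Qed.

Lemma short_induced_path_closes l p : l <= 3 -> is_induced_path l p ->
  closes_to_induced_cycle p.
Proof.
move=> l3 ip; apply: on_induced_cycle_closes (ip) _.
have cp := induced_path_chordless ip; case: ip => -[szp _ _] _.
case: p szp cp => [//|x0 [|x1 [|x2 [|x3 [|x4 p]]]]] szp cp.
- exact: vertex_on_induced_cycle.
- by apply: adj_on_induced_cycle; apply: (chordless_adj x0 cp (i := 0) (j := 1)).
- exact: induced_path2_on_induced_cycle.
- exact: induced_path3_on_induced_cycle.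
by case: szp l3 => <-.
Qed.

End ShortPaths.

(** * An obstruction to closing *)

Section Obstruction.

Variable G : sgraph.
Implicit Types (w x y z : G) (p c s : seq G).

Lemma mem_zip_rot1 c x y : uniq c -> (x, y) \in zip c (rot 1 c) -> y = next c x.
Proof.
move=> uc xy.
have szc : size c = size (rot 1 c) by rewrite size_rot.
case/(nthP (x, y)): xy => i; rewrite size_zip -szc minnn => ic.
rewrite nth_zip // => -[xE <-]; rewrite -xE next_nth mem_nth // index_uniq //.
case: c ic {uc xE szc} => // z c; rewrite rot1_cons /= ltnS => ic.
have [ltic|] := ltnP i (size c).
  by rewrite nth_rcons ltic; apply: set_nth_default.
move=> leci; have -> : i = size c by apply/eqP; rewrite eqn_leq ic.
by rewrite nth_rcons ltnn eqxx nth_default.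
Qed.

Lemma induced_cycle_adj c x y : is_induced_cycle c ->
  x \in c -> y \in c -> adj x y -> y \in [:: next c x; prev c x].
Proof.
case=> -[_ uc cc] /pairs_inducedP; move/(_ (zip_rot1_adj cc)) => ch cx cy xy.
rewrite !inE; have [||/(mem_zip_rot1 uc)->|/(mem_zip_rot1 uc)->] := ch x y _ _ xy.
- by rewrite inE.
- by rewrite inE.
- by rewrite eqxx.
by rewrite prev_next // eqxx orbT.
Qed.

Lemma next_neq_prev c x : 2 < size c -> uniq c -> x \in c ->
  next c x != prev c x.
Proof.
move=> szc uc cx; apply/eqP => eq_np.
have: next c (next c x) = x by rewrite eq_np next_prev.
have [i c' E] := rot_to cx; have := rot_uniq i c; rewrite uc.
rewrite -!(next_rot i uc) E -(size_rot i) E in szc *.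
case: c' {E} szc => [|y [|z c']] //= _.
rewrite !inE !negb_or => /andP[/andP[/negPf xy /andP[xz _]] _].
by rewrite eqxx eq_sym xy eqxx => zx; rewrite zx eqxx in xz.
Qed.

(** A cycle through the path leaves [x0] by some [w] other than [x1]. Then [y] has the three
    neighbours [w], [a], [b] on the cycle, but a vertex of an induced cycle has only two there. *)
Lemma path_not_on_induced_cycle x0 x1 p :
  let q := [:: x0, x1 & p] in
  (forall w, adj x0 w -> w != x1 ->
     exists y a b, [/\ {subset [:: y; a; b] <= q}, uniq [:: w; a; b],
       adj y w, adj y a & adj y b]) ->
  forall c, is_induced_cycle c ->
    ~ is_subgraph (path_subgraph q) (cycle_subgraph c).
Proof.
move=> q dominated c ic [/= /subsetP sub_qc _].
have qc x : x \in q -> x \in c by move=> qx; have := sub_qc x; rewrite !inE => ->.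
have [[szc uc cc] _] := ic; have c0 : x0 \in c by apply/qc/mem_head.
have [w [cw x0w wx1]] : exists w, [/\ w \in c, adj x0 w & w != x1].
  have := next_neq_prev szc uc c0; have [nx1|nx1 _] := eqVneq (next c x0) x1.
    rewrite nx1 eq_sym => px1; exists (prev c x0).
    by rewrite mem_prev px1 adj_sym (prev_cycle cc).
  by exists (next c x0); rewrite mem_next nx1 (next_cycle cc).
have [y [a [b [yabq uwab yw ya yb]]]] := dominated w x0w wx1.
have [cy ca cb] : [/\ y \in c, a \in c & b \in c].
  by split; apply/qc/yabq; rewrite !inE eqxx ?orbT.
have: {subset [:: w; a; b] <= [:: next c y; prev c y]}.
  by apply/allP/and4P; split=> //; apply: induced_cycle_adj.
by move/(uniq_leq_size uwab).
Qed.

End Obstruction.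

(** * Length 4: a Paley graph *)

Section Paley13.
Import GRing.Theory.
Local Open Scope ring_scope.

(** Euler's criterion: the sixth power is 1 exactly for the nonzero squares modulo 13. *)
Definition paley_adj (x y : 'F_13) := (x - y) ^+ 6 == 1.

Lemma paley_adj_sym : symmetric paley_adj.
Proof. by move=> x y; rewrite /paley_adj -opprB exprNn -signr_odd mul1r. Qed.

Lemma paley_adj_irrefl : irreflexive paley_adj.
Proof. by move=> x; rewrite /paley_adj subrr expr0n eq_sym oner_eq0. Qed.

Definition paley13 : sgraph := SGraph paley_adj_sym paley_adj_irrefl.

Lemma paley13_connected : connected paley13.
Proof.
split; first by rewrite card_ord.
(* Walk from [x] to [y] in steps of 1, which is a square. *)
move=> /= x y; rewrite -[y](subrK x) addrC -[y - x]natr_Zp.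
elim: (nat_of_ord _) => [|k IHk]; first by rewrite addr0.
apply: connect_trans IHk (connect1 _).
by rewrite /= /paley_adj -[k.+1]addn1 natrD addrA opprD addrA subrr add0r.
Qed.

Lemma paley13_edge_transitive : edge_transitive paley13.
Proof.
move=> e f /imsetP[[u v]]; rewrite inE /= => uv -> /imsetP[[u' v']].
rewrite inE /= => uv' ->.
have nz (x y : 'F_13) : paley_adj x y -> x - y != 0.
  by apply: contraTneq => xy; rewrite /paley_adj xy expr0n eq_sym oner_eq0.
pose a := (v' - u') / (v - u) : 'F_13.
have a6 : a ^+ 6 = 1.
  rewrite paley_adj_sym in uv; rewrite paley_adj_sym in uv'.
  by rewrite exprMn exprVn (eqP uv) (eqP uv') invr1 mulr1.
have a0 : a != 0 by apply: contra_eq_neq a6 => ->; rewrite expr0n eq_sym oner_eq0.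
(* This affine map sends [u] to [u'] and [v] to [v']; it preserves adjacency because its slope
   satisfies $a^6 = 1$. *)
have inj_g : injective (fun x : paley13 => a * (x - u) + u' : paley13).
  by move=> x y /addIr/(mulfI a0)/addIr.
exists (perm inj_g) => [x y|].
  rewrite !permE /= /paley_adj opprD addrACA subrr addr0 -mulrBr.
  by rewrite opprB addrA subrK exprMn a6 mul1r.
rewrite imsetU1 imset_set1 !permE subrr mulr0 add0r divfK ?subrK //.
by apply: nz; rewrite paley_adj_sym.
Qed.

Lemma paley13_path : exists p : seq paley13, is_induced_path 4 p /\
  forall c : seq paley13, is_induced_cycle c ->
    ~ is_subgraph (path_subgraph p) (cycle_subgraph c).
Proof.
pose v k : paley13 := inZp k.
exists [:: v 0; v 1; v 2; v 6; v 7]; split.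
  by apply: chordless_induced_path => //; vm_compute.
apply: path_not_on_induced_cycle => w v0w wv1.
(* Each interior vertex with its two neighbours on the path. The other neighbours of 0 are 3, 4, 9,
   10 and 12: 4 and 10 are adjacent to 1, 3 and 12 to 2, and 9 to 6. *)
pose triple := [:: (1, (0, 2)); (2, (1, 6)); (6, (2, 7))]%N.
pose spoils (w : paley13) (t : nat * (nat * nat)) :=
  [&& uniq [:: w; v t.2.1; v t.2.2], adj (v t.1) w, adj (v t.1) (v t.2.1)
    & adj (v t.1) (v t.2.2)].
have: all (fun k => [==> adj (v 0) (v k), v k != v 1 => has (spoils (v k)) triple])
        (iota 0 13) by vm_compute.
move/allP/(_ w); rewrite mem_iota ltn_ord => /(_ isT).
rewrite /v (valZpK w) v0w wv1 !implyTb => /hasP[[y [a b]] t_in /and4P[/= u3 yw ya yb]].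
exists (v y), (v a), (v b); split=> //.
by move: t_in; rewrite !inE => /or3P[] /eqP[-> -> ->]; apply/allP; vm_compute.
Qed.
End Paley13.

(** * Length at least 5: points and 3-subsets *)

(** A permutation matching the tails is corrected at the heads by a transposition, which fixes the
    images of the tail. *)
Lemma perm_map_uniq (T : finType) (s t : seq T) :
  uniq s -> uniq t -> size s = size t -> exists g : {perm T}, map g s = t.
Proof.
elim: s t => [|x s IHs] [|y t] //=; first by exists 1%g.
case/andP=> xNs us /andP[yNt ut] [/(IHs t us ut)[g gs]].
exists (g * tperm (g x) y)%g; rewrite permM tpermL; congr (_ :: _).
rewrite -gs; apply/eq_in_map=> z sz; rewrite permM tpermD //.
  by rewrite (inj_eq perm_inj); apply: contraNneq xNs => ->.
by apply: contraNneq yNt => ->; rewrite -gs map_f.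
Qed.

Section Incidence.

Variable T : finType.

(** Points are encoded as singletons, so that incidence is proper inclusion and permutations act on
    points and blocks alike. *)
Definition point_or_block (A : {set T}) := (#|A| == 1) || (#|A| == 3).

Definition flag_vertex := {A : {set T} | point_or_block A}.
Implicit Types A B : flag_vertex.

Definition flag_adj A B := (val A \proper val B) || (val B \proper val A).

Lemma flag_adj_sym : symmetric flag_adj.
Proof. by move=> A B; rewrite /flag_adj orbC. Qed.

Lemma flag_adj_irrefl : irreflexive flag_adj.
Proof. by move=> A; rewrite /flag_adj properxx. Qed.

Definition flag_graph : sgraph := SGraph flag_adj_sym flag_adj_irrefl.

Lemma flag_properP A B : val A \proper val B ->
  exists a b c, [/\ uniq [:: a; b; c], val A = [set a] &
                    val B = [set x in [:: a; b; c]]].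
Proof.
move=> pAB; have ltAB := proper_card pAB.
have [cA cB] : #|val A| == 1 /\ #|val B| == 3.
  move: (valP A) (valP B) ltAB; rewrite /point_or_block.
  by move=> /orP[]/eqP-> /orP[]/eqP->.
have [a Aa] := cards1P cA; exists a.
have aB : a \in val B by apply: (subsetP (proper_sub pAB)); rewrite Aa set11.
have: #|val B :\ a| == 2 by move: cB; rewrite (cardsD1 a) aB.
case/cards2P=> b [c [bc Bbc]]; exists b, c; split=> //.
  have: b \in val B :\ a by rewrite Bbc set21.
  have: c \in val B :\ a by rewrite Bbc set22.
  by rewrite /= !inE !negb_or bc ![_ == a]eq_sym => /andP[-> _] /andP[-> _].
by rewrite -(setD1K aB) Bbc; apply/setP=> x; rewrite !inE.
Qed.

Lemma perm_flag_subproof (g : {perm T}) A : point_or_block (g @: val A).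
Proof. by rewrite /point_or_block card_imset; [apply: (valP A) | apply: perm_inj]. Qed.

Definition perm_flag (g : {perm T}) A : flag_graph :=
  Sub (g @: val A) (perm_flag_subproof g A).

Lemma perm_flag_inj g : injective (perm_flag g).
Proof.
by move=> A B /(congr1 val) /= /(imset_inj perm_inj); apply: val_inj.
Qed.

Lemma perm_flag_automorphism g : is_automorphism (perm (@perm_flag_inj g)).
Proof.
have sub (A B : {set T}) : (g @: A \subset g @: B) = (A \subset B).
  apply/idP/idP => [/subsetP gAB|]; last exact: imsetS.
  by apply/subsetP=> x Ax; rewrite -(mem_imset _ _ (@perm_inj _ g)) gAB ?imset_f.
by move=> A B; rewrite !permE /= /flag_adj /= /proper !sub.
Qed.

Lemma flag_graph_edge_transitive : edge_transitive flag_graph.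
Proof.
have flag e : e \in edges flag_graph ->
    exists A B : flag_graph, e = [set A; B] /\ val A \proper val B.
  case/imsetP=> [[A B]]; rewrite inE => /orP[] /= pAB ->; first by exists A, B.
  by exists B, A; rewrite setUC.
move=> _ _ /flag[A [B [-> pAB]]] /flag[A' [B' [-> pAB']]].
have [a [b [c [uabc Aa Babc]]]] := flag_properP pAB.
have [a' [b' [c' [uabc' Aa' Babc']]]] := flag_properP pAB'.
(* Each triple lists the point first, so matching the triples in order matches both points and
   blocks. *)
have [g gabc] := perm_map_uniq uabc uabc' erefl.
exists (perm (@perm_flag_inj g)); first exact: perm_flag_automorphism.
rewrite imsetU1 imset_set1 !permE; congr [set _; _]; apply: val_inj => /=.
  by rewrite Aa Aa' imset_set1; case: gabc => ->.
rewrite Babc Babc' -gabc; apply/setP=> x; rewrite [RHS]inE.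
by apply/imsetP/mapP=> -[y]; rewrite ?inE => yabc ->; exists y; rewrite ?inE.
Qed.

Lemma point_subproof x : point_or_block [set x].
Proof. by rewrite /point_or_block cards1. Qed.

Definition point x : flag_graph := Sub [set x] (point_subproof x).

Lemma point_adj x B : #|val B| = 3 -> adj (point x) B = (x \in val B).
Proof.
move=> cB; rewrite /= /flag_adj /= !properE !sub1set; apply/orP/idP => [[]/andP[]|xB].
- by [].
- by move/subset_leq_card; rewrite cB cards1.
left; rewrite xB; apply/negP=> /subset_leq_card; by rewrite cB cards1.
Qed.

(** Two distinct points share a block, completed by a third element, and every block is adjacent to
    a point. *)
Lemma flag_graph_connected : 2 < #|T| -> connected flag_graph.
Proof.
move=> T3; have /card_gt0P[o _] : 0 < #|T| by apply: ltn_trans T3.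
have csym : connect_sym (@adj flag_graph).
  by apply: sym_connect_sym; apply: adj_sym.
split=> [|A B]; first by apply/card_gt0P; exists (point o).
suff to_o A' : connect (@adj flag_graph) A' (point o).
  by apply: connect_trans (to_o A) _; rewrite csym.
have pt_o x : connect (@adj flag_graph) (point x) (point o).
  have [->//|xo] := eqVneq x o.
  have [z zNxo] : exists z, z \notin [set x; o].
    apply/existsP; rewrite -negb_forall; apply: contraL T3 => /forallP all_xo.
    rewrite -leqNgt -cardsT -[2]/(true.+1) -xo -cards2.
    by apply/subset_leq_card/subsetP=> z _; apply: all_xo.
  have c3 : #|z |: [set x; o]| = 3 by rewrite cardsU1 zNxo cards2 xo.
  have Pz : point_or_block (z |: [set x; o]) by rewrite /point_or_block c3.
  pose C : flag_graph := Sub (z |: [set x; o]) Pz.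
  apply: (@connect_trans _ _ C); apply: connect1; last rewrite adj_sym.
    by rewrite point_adj // !inE eqxx orbT.
  by rewrite point_adj // !inE eqxx !orbT.
case/orP: (valP A') => [/cards1P[x Ax]|/eqP cA].
  by rewrite (_ : A' = point x) //; apply: val_inj.
have /card_gt0P[x Ax] : 0 < #|val A'| by rewrite cA.
by apply: connect_trans (pt_o x); apply: connect1; rewrite adj_sym point_adj.
Qed.

End Incidence.

(** * An explicit induced path in the incidence graph *)

Section LongPath.

Variable n : nat.
Notation G := (flag_graph 'I_n.+1).
Implicit Types s t : seq nat.

Definition label_set s : {set 'I_n.+1} := [set x : 'I_n.+1 | val x \in s].

(** Labels are natural numbers, so that incidences become arithmetic. The point 0 is a default
    value, never reached for [valid_labels]. *)
Definition label_vertex s : G := insubd (point ord0) (label_set s).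

Definition valid_labels s :=
  [&& uniq s, all (fun i => i < n.+1) s & (size s == 1) || (size s == 3)].

Lemma card_label_set s : valid_labels s -> #|label_set s| = size s.
Proof.
case/and3P=> us /allP bs _; rewrite cardE -(size_map val); apply/perm_size/uniq_perm.
- by rewrite map_inj_uniq ?enum_uniq //; apply: val_inj.
- exact: us.
move=> i; apply/mapP/idP => [[x + ->]|si]; first by rewrite mem_enum inE.
by exists (Ordinal (bs i si)); rewrite ?mem_enum ?inE.
Qed.

Lemma val_label_vertex s : valid_labels s -> val (label_vertex s) = label_set s.
Proof.
move=> gs; rewrite insubdK // /in_mem /= /point_or_block card_label_set //.
by case/and3P: gs.
Qed.

Lemma label_vertex_inj s t : valid_labels s -> valid_labels t ->
  label_vertex s = label_vertex t -> s =i t.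
Proof.
have sub s1 s2 : valid_labels s1 -> label_set s1 = label_set s2 -> {subset s1 <= s2}.
  case/and3P=> _ /allP bs1 _ /setP eq12 i s1i.
  by have := eq12 (Ordinal (bs1 i s1i)); rewrite !inE /= s1i => /esym.
move=> gs gt /(congr1 val); rewrite !val_label_vertex // => st i.
by apply/idP/idP; apply: sub.
Qed.

Lemma label_vertex_adj_same s t :
  valid_labels s -> valid_labels t -> size s = size t ->
  adj (label_vertex s) (label_vertex t) = false.
Proof.
move=> gs gt st; apply/negP=> /orP[] /proper_card;
  by rewrite !val_label_vertex // !card_label_set // st ltnn.
Qed.

Lemma label_vertex_adj_point i t :
  valid_labels [:: i] -> valid_labels t -> size t = 3 ->
  adj (label_vertex [:: i]) (label_vertex t) = (i \in t).
Proof.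
move=> gi gt t3; have /and3P[_ /andP[lti _] _] := gi.
have -> : label_vertex [:: i] = point (Ordinal lti).
  by apply: val_inj; rewrite val_label_vertex //; apply/setP=> x; rewrite !inE.
by rewrite point_adj val_label_vertex // ?card_label_set // inE.
Qed.

(* Blocks sit at the even positions, points at the odd ones. The third element
   of block [k] is [1] if [k] is [1] and [0] otherwise, so that the two points
   0 and 1 of block 0 off the path lie in blocks 2 and 1. *)
Definition path_labels j : seq nat :=
  if odd j then [:: j./2.+2] else [:: j./2.+1; j./2.+2; nat_of_bool (j./2 == 1)].

Lemma path_labels_valid j : j./2.+2 <= n -> valid_labels (path_labels j).
Proof.
move=> jn; rewrite /valid_labels /path_labels; case: (odd j) => /=; rewrite ?inE; lia.
Qed.

Lemma size_path_labels j : size (path_labels j) = if odd j then 1 else 3.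
Proof. by rewrite /path_labels; case: (odd j). Qed.

(** The largest label is [j./2.+2] in both cases, and the size gives the parity. *)
Lemma path_labels_inj i j : path_labels i =i path_labels j ->
  size (path_labels i) = size (path_labels j) -> i = j.
Proof.
move=> eq_l; rewrite !size_path_labels; have := eq_l i./2.+2; have := eq_l j./2.+2.
have := odd_double_half i; have := odd_double_half j; rewrite /path_labels.
case: (odd i); case: (odd j) => //=; rewrite !inE; lia.
Qed.

(** Points on the path have labels at least 2, so the third element of a block, 0 or 1, causes no
    chord. *)
Lemma path_labels_adj i j : i < j -> j./2.+2 <= n ->
  adj (label_vertex (path_labels i)) (label_vertex (path_labels j)) = (j == i.+1).
Proof.
move=> ij jn; have in_ : i./2.+2 <= n by lia.
have gi := path_labels_valid in_; have gj := path_labels_valid jn.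
have := odd_double_half i; have := odd_double_half j; move: gi gj.
have := size_path_labels i; have := size_path_labels j.
rewrite /path_labels; case: (odd i); case: (odd j) => sj si gi gj Ej Ei.
- by rewrite label_vertex_adj_same //; apply/esym/negbTE; lia.
- by rewrite label_vertex_adj_point // !inE; lia.
- by rewrite adj_sym label_vertex_adj_point // !inE; lia.
by rewrite label_vertex_adj_same //; apply/esym/negbTE; lia.
Qed.

End LongPath.

(** The block at position 4 must have both its path neighbours, at positions 3 and 5, on the path;
    hence length at least 5. *)
Lemma flag_graph_path l (G := flag_graph 'I_(l + 4)) : 4 < l ->
  exists p : seq G, is_induced_path l p /\
    forall c : seq G, is_induced_cycle c ->
      ~ is_subgraph (path_subgraph p) (cycle_subgraph c).
Proof.
rewrite /G {G} addnS; set n := l + 3; move=> l4.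
pose f j : flag_graph 'I_n.+1 := label_vertex n (path_labels j).
have bound j : j <= l -> j./2.+2 <= n by rewrite /n; lia.
have f_inj i j : i <= l -> j <= l -> f i = f j -> i = j.
  move=> il jl eq_f; apply: path_labels_inj.
    by apply: label_vertex_inj eq_f; apply/path_labels_valid/bound.
  by rewrite -!(@card_label_set n) -?val_label_vertex ?[label_vertex n _]eq_f //; apply/path_labels_valid/bound.
exists (mkseq f l.+1); split.
  apply: chordless_induced_path; first by rewrite size_mkseq.
  apply: (@chordless_nth _ (f 0)) => [|i j ij].
    rewrite map_inj_in_uniq ?iota_uniq // => i j.
    by rewrite !mem_iota /= !ltnS; apply: f_inj.
  rewrite size_mkseq => jl; rewrite !nth_mkseq //; last exact: ltn_trans jl.
  by apply: path_labels_adj => //; apply: bound.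
have mem_f j : j <= l -> f j \in mkseq f l.+1.
  by move=> jl; apply: map_f; rewrite mem_iota.
(* A successor in place of [l] exposes the first two vertices of the path. *)
case: l @n @f bound f_inj l4 mem_f => // l n f bound f_inj l4 mem_f.
apply: path_not_on_induced_cycle => w f0w wf1.
have [i i012 wE] : exists2 i, i \in [:: 1; 2; 0] & w = label_vertex n [:: i].
  case/orP: f0w => p0w; last first.
    have [a [b [c [_ wa]]]] := flag_properP p0w.
    rewrite /f val_label_vertex ?path_labels_valid ?bound // => f0E; exists (val a).
      have : a \in label_set n (path_labels 0) by rewrite f0E inE mem_head.
      by rewrite inE.
    apply: val_inj; rewrite val_label_vertex ?wa; last by rewrite /valid_labels /= ltn_ord.
    by apply/setP=> x; rewrite !inE.
  have := proper_card p0w; rewrite /f val_label_vertex ?card_label_set ?path_labels_valid ?bound //=.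
  by case/orP: (valP w) => /eqP->.
have vneq a b : a <= n -> b <= n -> a != b -> label_vertex n [:: a] != label_vertex n [:: b].
  move=> an bn; apply: contraNneq => /label_vertex_inj eq_ab.
  by have := eq_ab _ _ a; rewrite !inE eqxx => <- //; rewrite /valid_labels /= ltnS ?an ?bn.
(* The block at position [y.*2] contains [i] and its two neighbouring path points, whose labels
   [y.+1] and [y.+2] differ from [i] because [i < 2]. *)
have spoiled y : 0 < y <= 2 -> i \in path_labels y.*2 -> i < 2 ->
    exists y a b, [/\ {subset [:: y; a; b] <= mkseq f l.+2},
       uniq [:: w; a; b], adj y w, adj y a & adj y b].
  case/andP=> y0 y2 iy i2; exists (f y.*2), (f y.*2.-1), (f y.*2.+1).
  have fE z : odd z -> f z = label_vertex n [:: z./2.+2] by rewrite /f /path_labels => ->.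
  split.
  - by apply/allP/and4P; split=> //; apply: mem_f; lia.
  - by rewrite wE !fE /= ?inE ?negb_or ?vneq // /n; lia.
  - rewrite adj_sym wE label_vertex_adj_point //; last by rewrite size_path_labels odd_double.
      by rewrite /valid_labels /= /n; lia.
    by apply/path_labels_valid/bound; lia.
  - by rewrite adj_sym path_labels_adj ?bound //; lia.
  by rewrite path_labels_adj ?bound //; lia.
(* Point 1 lies in the block at position 2, point 2 is the second vertex of the path, and point 0
   lies in the block at position 4. *)
move: i012; rewrite !inE => /or3P[]/eqP i_eq; rewrite i_eq in wE spoiled.
- exact: (spoiled 1).
- by rewrite wE eqxx in wf1.
exact: (spoiled 2).
Qed.

Theorem theorem1p9 :
  (forall G : sgraph, connected G -> edge_transitive G -> ~ is_star G ->
     forall (l : nat) (p : seq G), l <= 3 -> is_induced_path l p ->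
       closes_to_induced_cycle p)
  /\
  (forall l : nat, 4 <= l ->
     exists G : sgraph, [/\ connected G, edge_transitive G &
       exists p : seq G, is_induced_path l p /\
         forall c : seq G, is_induced_cycle c ->
           ~ is_subgraph (path_subgraph p) (cycle_subgraph c)]).
Proof.
split=> [G conn et Nstar l p|l l4]; first exact: short_induced_path_closes.
have [<-|l_neq4] := eqVneq 4 l.
  exists paley13; split; [exact: paley13_connected | | exact: paley13_path].
  exact: paley13_edge_transitive.
exists (flag_graph 'I_(l + 4)); split.
- by apply: flag_graph_connected; rewrite card_ord; lia.
- exact: flag_graph_edge_transitive.
by apply: flag_graph_path; lia.
Qed.
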